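(* Let $M$ be a finite subset of a metric space $X$, and let $n=\#M$. Let $d$ be an arbitrary real number with $d>\operatorname{smt}(M,X)$ (for example, any $d>(n-1)\operatorname{diam}M$), and let $\lambda$ be an arbitrary real number with $\lambda\ge 2d$. Then $$ \operatorname{smt}(M,X)=\inf\biggl\{\sum_{k=1}^\infty\bigl[\lambda-2\,d_{GH}(V,\lambda\Delta_{k+1})\bigr]:V\in\mathcal{M}(M,X,d)\biggr\}. $$
   Context: For a metric space, $|xy|$ denotes the distance between points $x$ and $y$, and $\#M$ is the cardinality of $M$. $d_{GH}$ denotes the Gromov--Hausdorff distance: $d_{GH}(X,Y)$ is the infimum of real numbers $r$ such that there exist a metric space $Z$ and subsets $X',Y'\subset Z$ isometric to $X$ and $Y$ respectively with Hausdorff distance $d_H(X',Y')\le r$. For $\lambda>0$, $\lambda\Delta_m$ denotes the metric space on $\{1,\ldots,m\}$ all of whose nonzero distances equal $\lambda$. Steiner minimal tree length: a graph $G=(V,E)$ is defined on a metric space $X$ if $V\subset X$; the length of an edge $vw$ is $|vw|$ and the length $|G|$ of $G$ is the sum of the lengths of its edges. For a nonempty finite $M\subset X$, a connected graph $G=(V,E)$ on $X$ joins $M$ if $M\subset V$. The number $\operatorname{smt}(M,X)$ is the infimum of the lengths of the connected graphs on $X$ that join $M$. For an $n$-point subset $M\subset X$ and a real number $d$, $\mathcal{M}(M,X,d)$ is the family of (isometry classes of) subsets $V\subset X$, with the metric induced from $X$, such that $M\subset V$, $\#V\le 2n-2$ and $\operatorname{diam}V\le d$. *)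

(* Defs.v *)
From HB Require Import structures.
From mathcomp Require Import all_boot all_order all_algebra finmap.
From mathcomp Require Import all_classical all_reals all_analysis.

Set Implicit Arguments.
Unset Strict Implicit.
Unset Printing Implicit Defensive.

Import Order.TTheory GRing.Theory Num.Theory.

Local Open Scope classical_set_scope.
Local Open Scope ring_scope.

(* [sup] and [inf] below are the real-valued ones of the library: they are 0 on
   the empty set and on unbounded sets. *)

Section metric_notions.
Context {R : realType}.

Definition diam (X : metricType R) (A : set X) : R :=
  sup [set mdist p.1 p.2 | p in A `*` A].

Definition dist_to_set (Z : metricType R) (A : set Z) (z : Z) : \bar R :=
  ereal_inf [set (mdist z a)%:E | a in A].

Definition hausdorff_dist (Z : metricType R) (A B : set Z) : \bar R :=
  maxe (ereal_sup (dist_to_set B @` A)) (ereal_sup (dist_to_set A @` B)).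

(* Subsets of metric spaces carry the induced metric. *)
Definition isometric (X Y : metricType R) (A : set X) (B : set Y) : Prop :=
  exists2 f : X -> Y,
    forall x y, A x -> A y -> mdist (f x) (f y) = mdist x y & f @` A = B.

Definition dGH (X Y : metricType R) (A : set X) (B : set Y) : R :=
  inf [set r : R | exists (Z : metricType R) (A' B' : set Z),
    [/\ isometric A A', isometric B B' & (hausdorff_dist A' B' <= r%:E)%E]].

End metric_notions.

(* The space lambda Delta_m, with 0, ..., m - 1 in place of 1, ..., m. *)
Section simplex.
Context {R : realType}.

Definition simplex (lambda : {posnum R}) (m : nat) : Type := 'I_m.

Variables (lambda : {posnum R}) (m : nat).

HB.instance Definition _ := Finite.on (simplex lambda m).

Definition simplex_dist (i j : simplex lambda m) : R :=
  if i == j then 0 else lambda%:num.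

Let simplex_distxx i : simplex_dist i i = 0.
Proof. by rewrite /simplex_dist eqxx. Qed.

Let simplex_dist_eq0 i j : simplex_dist i j = 0 -> i = j.
Proof.
by rewrite /simplex_dist; case: eqP => // _ /eqP; rewrite gt_eqF.
Qed.

Let simplex_distC i j : simplex_dist i j = simplex_dist j i.
Proof. by rewrite /simplex_dist eq_sym. Qed.

Let simplex_dist_triangle j i k :
  simplex_dist i k <= simplex_dist i j + simplex_dist j k.
Proof.
rewrite /simplex_dist; case: (eqVneq i j) => [<-|_]; first by rewrite add0r.
by case: (i == k); case: (j == k); rewrite ?addr0 ?addr_ge0 ?lerDl.
Qed.

HB.instance Definition _ := isMetric.Build R (simplex lambda m)
  simplex_distxx simplex_dist_eq0 simplex_distC simplex_dist_triangle.

End simplex.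

Section steiner.
Local Open Scope fset_scope.
Context {R : realType} {X : metricType R}.

(* Finite simple graphs on X; an edge vw is the two-point set [fset v; w]. *)
Record graph := Graph {
  vertices : {fset X};
  edges : {fset {fset X}};
  edgesP : forall e, e \in edges -> e `<=` vertices /\ #|` e| = 2
}.

Definition adjacent (G : graph) : rel (vertices G) :=
  fun v w => [fset val v; val w] \in edges G.

Definition connected_graph (G : graph) : Prop :=
  forall v w : vertices G, connect (@adjacent G) v w.

Definition joins (G : graph) (M : {fset X}) : Prop := M `<=` vertices G.

(* The length |vw| of an edge is the diameter of {v, w}, see [diam_pair]. *)
Definition edge_length (e : {fset X}) : R := diam [set` e].

Lemma diam_pair (v w : X) : edge_length [fset v; w] = mdist v w.
Proof.
have mem u : [set` [fset v; w]] u -> u = v \/ u = w.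
  by rewrite /= !inE => /orP[] /eqP; [left|right].
have vP : [set` [fset v; w]] v by rewrite /= !inE eqxx.
have wP : [set` [fset v; w]] w by rewrite /= !inE eqxx orbT.
have ub : ubound [set mdist p.1 p.2 | p in
    ([set` [fset v; w]] `*` [set` [fset v; w]])%classic] (mdist v w).
  move=> _ [[x y] [/= /mem xvw /mem yvw] <-] /=.
  case: xvw yvw => -> [] -> //.
  - by rewrite mdistxx mdist_ge0.
  - by rewrite metric_sym.
  - by rewrite mdistxx mdist_ge0.
apply/eqP; rewrite eq_le; apply/andP; split.
  by by apply: ge_sup => //; exists (mdist v w); exists (v, w).
apply: ub_le_sup; first by exists (mdist v w).
by exists (v, w).
Qed.

Definition graph_length (G : graph) : R := \sum_(e <- edges G) edge_length e.

Definition smt (M : {fset X}) : R :=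
  inf [set graph_length G | G in [set G | connected_graph G /\ joins G M]].

(* The family M(M, X, d), with subsets of X in place of isometry classes. *)
Definition steiner_family (M : {fset X}) (d : R) : set {fset X} :=
  [set V | [/\ M `<=` V, (#|` V| <= 2 * #|` M| - 2)%N & diam [set` V] <= d]].

End steiner.

(* Main.v *)
(* For a finite [V] with [2 * diam V <= lambda], the [k]-th term
   [lambda - 2 d_GH(V, lambda Delta_{k+1})] is the largest gap between the
   classes of a partition of [V] into [k + 1] classes, and is 0 when
   [k >= #V].
   Kruskal's greedy algorithm builds a tree on [V] whose edges are bounded by
   successive terms, so [smt M] is at most the sum for every [V] containing [M].
   Conversely, removing the [k - 1] longest edges of a connected graph leaves at
   most [k] components, so every partition of [V] into [k + 1] classes is crossed
   by one of the other edges, and the sum is at most the length of the graph.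
   A connected graph joining [M] is brought down to [2n - 2] vertices, without
   growing, by passing to a spanning tree and contracting vertices outside [M]
   of degree at most 2 onto a neighbour. *)
From HB Require Import structures.
Require Import Defs.
From mathcomp Require Import all_boot all_order all_algebra finmap.
From mathcomp Require Import all_classical all_reals all_analysis.
From mathcomp Require Import lra zify.

Import Order.TTheory GRing.Theory Num.Theory.

Local Open Scope classical_set_scope.
Local Open Scope ring_scope.

(** * Connectivity of edge lists, tested by cuts *)

Section edge_lists.
Context {T : choiceType}.
Implicit Types (V : {fset T}) (L : seq (T * T)) (e : T * T).

(* [L] joins all the points of [V]: no cut of [T] that separates points of [V]
   avoids all the edges of [L]. *)
Definition spans V L := forall g : T -> bool,
  {in L, forall e, g e.1 = g e.2} -> {in V &, forall x y, g x = g y}.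

Definition edges_in V L := {in L, forall e, (e.1 \in V) && (e.2 \in V)}.

(** The cut to use is the fibre of [g] through one of the two points. This extends the defining
    property from Boolean to arbitrary values. *)
Lemma spans_eq (U : eqType) V L (g : T -> U) : spans V L ->
  {in L, forall e, g e.1 = g e.2} -> {in V &, forall x y, g x = g y}.
Proof.
move=> VL gL x y xV yV; apply/esym/eqP.
rewrite (VL (fun z => g z == g x) _ y x) // => e eL.
by rewrite gL.
Qed.

End edge_lists.

Definition map_edge {T U : Type} (f : T -> U) (e : T * T) : U * U :=
  (f e.1, f e.2).

Lemma spans_map (T U : choiceType) (f : T -> U) (V : {fset T}) L :
  spans V L -> spans (f @` V)%fset (map (map_edge f) L).
Proof.
move=> VL g gL _ _ /imfsetP[x xV ->] /imfsetP[y yV ->].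
apply: (VL (g \o f)) => // e eL /=.
exact: (gL _ (map_f (map_edge f) eL)).
Qed.

Lemma spans_cons_loop (T : choiceType) (V : {fset T}) L a :
  spans V ((a, a) :: L) -> spans V L.
Proof.
move=> VL g gL; apply: VL => e; rewrite inE => /predU1P[-> //|]; exact: gL.
Qed.

Lemma spans_cat_loops (T : choiceType) (V : {fset T}) L1 L2 :
  {in L2, forall e, e.1 = e.2} -> spans V (L1 ++ L2) -> spans V L1.
Proof.
move=> loops VL g gL; apply: VL => e; rewrite mem_cat => /orP[/gL //|/loops ->//].
Qed.

(** * Contraction of edges and spanning trees *)

Section merging.
Context {T : choiceType}.
Implicit Types (V : {fset T}) (L : seq (T * T)) (e : T * T).

Definition merge_pt (a b z : T) : T := if z == b then a else z.

Lemma merge_pt_eq a b : merge_pt a b a = merge_pt a b b.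
Proof. by rewrite /merge_pt eqxx; case: ifP => // /eqP. Qed.

Lemma merge_pt_fset a b V : a \in V -> b != a ->
  (merge_pt a b @` V = V `\ b)%fset.
Proof.
move=> aV ba; apply/fsetP => z; rewrite !inE; apply/imfsetP/andP => /=.
  move=> [x xV ->]; rewrite /merge_pt; case: (eqVneq x b) => [_|->//].
  by rewrite eq_sym.
by move=> [zb zV]; exists z; rewrite // /merge_pt (negbTE zb).
Qed.

Lemma spans_merge a b V L : spans V ((a, b) :: L) ->
  spans (merge_pt a b @` V)%fset (map (map_edge (merge_pt a b)) L).
Proof.
move=> /(spans_map _ _ (merge_pt a b)) /=.
by rewrite /map_edge /= -merge_pt_eq => /spans_cons_loop.
Qed.

(** Contracting an edge removes at most one point from [V], and without edges [V] has at most one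
    point. *)
Lemma spans_size V L : spans V L -> (#|` V| <= (size L).+1)%N.
Proof.
have [n sz] := ubnP (size L).
elim: n L V sz => // n IH [|[a b] L] V sz VL.
  have [->|[x xV]] := fset_0Vmem V; first by rewrite cardfs0.
  rewrite -(cardfs1 x); apply/fsubset_leq_card/fsubsetP => y yV.
  rewrite inE; have /= -> // := VL (pred1 x) _ y x.
have mV : (#|` (merge_pt a b @` V)%fset| <= (size L).+1)%N.
  by have := IH _ _ _ (spans_merge _ _ _ _ VL); rewrite size_map; apply.
have sV : (V `<=` b |` (merge_pt a b @` V))%fset.
  apply/fsubsetP => z zV; rewrite !inE; case: eqVneq => //= zb.
  by apply/imfsetP; exists z; rewrite // /merge_pt (negbTE zb).
rewrite (leq_trans (fsubset_leq_card sV)) // cardfsU1 -add1n.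
by rewrite leq_add // leq_b1.
Qed.

(** Contract the first edge unless it is a loop, choose a tree in the contracted list by induction,
    and lift it by keeping the same positions of the original list. A tree is recorded through its
    number of edges. *)
Lemma spanning_tree V L : V != fset0 -> edges_in V L -> spans V L ->
  exists L', [/\ subseq L' L, spans V L' & (size L' < #|` V|)%N].
Proof.
have [n sz] := ubnP (size L).
elim: n L V sz => // n IH [|[a b] L] V sz V0 inL VL.
  by exists [::]; split=> //; rewrite cardfs_gt0.
have [ba|ba] := eqVneq b a.
  rewrite ba in VL inL *.
  have [|L' [sL VL' sz']] := IH L V sz V0 _ (spans_cons_loop _ _ _ _ VL).
    by move=> e eL; apply: inL; rewrite inE eL orbT.
  exists L'; split => //; exact: subseq_trans sL (subseq_cons _ _).
have /andP[/= aV bV] := inL _ (mem_head _ _).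
have := spans_merge _ _ _ _ VL; rewrite merge_pt_fset // => VL1.
have [|||L1 [/subseqP[m _ ->] VL2 sz']] := IH _ _ _ _ _ VL1.
- by rewrite size_map.
- by apply/fset0Pn; exists a; rewrite !inE eq_sym ba.
- move=> _ /mapP[e eL ->] /=.
  have /andP[e1 e2] : (e.1 \in V) && (e.2 \in V).
    by apply: inL; rewrite inE eL orbT.
  by rewrite -(merge_pt_fset a b) // !in_imfset.
exists ((a, b) :: mask m L); split.
- by rewrite /= eqxx mask_subseq.
- move=> g gL x y xV yV.
  have gab : g a = g b by exact: (gL _ (mem_head _ _)).
  have gm z : g (merge_pt a b z) = g z.
    by rewrite /merge_pt; case: eqVneq => // ->.
  rewrite -gm -[RHS]gm; apply: VL2; last 2 first.
  + by rewrite -(merge_pt_fset a b) // in_imfset.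
  + by rewrite -(merge_pt_fset a b) // in_imfset.
  move=> e; rewrite -map_mask => /mapP[e' e'L ->] /=; rewrite !gm.
  by apply: gL; rewrite inE e'L orbT.
- by move: sz'; rewrite -map_mask size_map (cardfsD1 b V) bV.
Qed.

End merging.

(** A path inequality proved without paths: contracting the first edge by a 1-Lipschitz map shortens
    [y - x] by at most the length of that edge. *)
Lemma spans_real (R : realType) (V : {fset R}) (L : seq (R * R)) : spans V L ->
  {in V &, forall x y, y - x <= \sum_(e <- L) `|e.1 - e.2|}.
Proof.
have [n sz] := ubnP (size L).
elim: n L V sz => // n IH [|[a b] L] V sz VL x y xV yV.
  by rewrite big_nil (spans_eq _ V [::] id VL _ x y) // subrr.
(* [h] collapses the interval between [a] and [b] and is 1-Lipschitz. *)
have [m [w [w0 mw]]] : exists m w, 0 <= w /\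
    ((a = m /\ b = m + w) \/ (b = m /\ a = m + w)).
  have [ab|/ltW ab] := leP a b.
    by exists a, (b - a); split; [lra|left; split; lra].
  by exists b, (a - b); split; [lra|right; split; lra].
have abw : `|a - b| = w.
  by case: mw => -[-> ->]; [rewrite distrC|]; rewrite (addrC m) addrK ger0_norm.
pose h t := Num.min t (Num.max m (t - w)).
have hE t : [\/ t <= m /\ h t = t, m <= t <= m + w /\ h t = m |
    m + w <= t /\ h t = t - w].
  rewrite /h minEle maxEle.
  have [?|?] := leP m (t - w).
    by constructor 3; split; [lra|case: leP => ?; lra].
  have [?|?] := leP t m; first by constructor 1.
  by constructor 2; split=> //; apply/andP; split; lra.
have hab : h a = h b.
  by have [] := hE a; have [] := hE b; case: mw => -[-> ->]; lra.
have h_lip s t : `|h s - h t| <= `|s - t|.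
  wlog st : s t / s <= t.
    move=> lip; case/orP: (le_total s t) => [/lip //|/lip].
    by rewrite distrC (distrC s).
  suff /andP[? ?] : h s <= h t <= h s + (t - s).
    by rewrite distrC (distrC s) !ger0_norm ?subr_ge0 // lerBlDl.
  by have [[? ->]|[/andP[? ?] ->]|[? ->]] := hE s;
    have [[? ->]|[/andP[? ?] ->]|[? ->]] := hE t; apply/andP; split; lra.
have h_le t : t - w <= h t <= t.
  by have [] := hE t => *; apply/andP; split; lra.
have hVL : spans (h @` V)%fset (map (map_edge h) L).
  have := spans_map _ _ h _ _ VL.
  by rewrite /= {1}/map_edge /= hab => /spans_cons_loop.
have hxy : h y - h x <= \sum_(e <- L) `|e.1 - e.2|.
  apply: le_trans (IH _ _ _ hVL _ _ _ _) _; rewrite ?size_map ?in_imfset //.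
  by rewrite big_map; apply: ler_sum => e _ /=; exact: h_lip.
rewrite big_cons /= abw; have := h_le x; have := h_le y; lra.
Qed.

(** * Lengths, degrees and the reduction of the vertex set *)

Section weighted_edge_lists.
Context {R : realType} {X : metricType R}.
Implicit Types (V M : {fset X}) (L : seq (X * X)).

Definition len L : R := \sum_(e <- L) mdist e.1 e.2.

Lemma len_ge0 L : 0 <= len L.
Proof. by apply: sumr_ge0 => e _; exact: mdist_ge0. Qed.

(** The 1-Lipschitz function [mdist x] carries the claim to the real line. *)
Lemma mdist_le_len V L : spans V L ->
  {in V &, forall x y, mdist x y <= len L}.
Proof.
move=> VL x y xV yV.
have := spans_real _ _ _ (spans_map _ _ (mdist x) _ _ VL).
move=> /(_ (mdist x x) (mdist x y)).
rewrite !in_imfset // mdistxx subr0 big_map => /(_ isT isT) /le_trans; apply.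
apply: ler_sum => e _ /=; rewrite ler_norml.
have := metric_triangle x e.1 e.2; have := metric_triangle x e.2 e.1.
by rewrite (metric_sym e.2 e.1) => ? ?; apply/andP; split; lra.
Qed.

Definition deg L (v : X) : nat := \sum_(e <- L) ((e.1 == v) + (e.2 == v)).

Lemma sum_indic_le1 V (a : X) : (\sum_(v <- V) (a == v) <= 1)%N.
Proof.
have [aV|aV] := boolP (a \in V); last first.
  rewrite big_seq big1 // => v vV; case: eqVneq aV => // ->.
  by rewrite vV.
rewrite (bigD1_seq a) ?fset_uniq //= eqxx big1 // => v va.
by rewrite eq_sym (negbTE va).
Qed.

(** The handshake identity, an inequality here because ends of edges may lie outside [V]. *)
Lemma sum_deg V L : (\sum_(v <- V) deg L v <= 2 * size L)%N.
Proof.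
rewrite exchange_big /=.
apply: (@leq_trans (\sum_(e <- L) 2)%N).
  apply: leq_sum => e _; rewrite big_split /=.
  exact: (leq_add (sum_indic_le1 _ _) (sum_indic_le1 _ _)).
by rewrite sum_nat_const_nat || rewrite big_const_seq count_predT iter_addn_0.
Qed.

(** Otherwise no edge would cross the cut that isolates [v], although [V] has another point. *)
Lemma incident_edge V L v : (1 < #|` V|)%N -> spans V L -> v \in V ->
  exists2 e, e \in L & (e.1 == v) != (e.2 == v).
Proof.
move=> V2 VL vV; apply: contrapT => noe.
have /fset0Pn[w] : (V `\ v != fset0)%fset.
  by rewrite -cardfs_gt0; move: V2; rewrite (cardfsD1 v V) vV.
rewrite !inE => /andP[/negP wv wV]; apply: wv.
have /= -> // := VL (pred1 v) _ w v.
by move=> e eL /=; apply: contrapT => /eqP ev; apply: noe; exists e.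
Qed.

Lemma deg_gt0 V L v : (1 < #|` V|)%N -> spans V L -> v \in V ->
  (0 < deg L v)%N.
Proof.
move=> V2 VL vV; have [e eL ev] := incident_edge _ _ _ V2 VL vV.
by rewrite /deg (big_rem e) //=; case: (_ == v) (_ == v) ev => [] [].
Qed.

(* Otherwise the degrees add up to at least [#M + 3 (#V - #M)], although a tree
   has degree sum [2 #V - 2]. *)
Lemma low_degree M V L : (1 < #|` M|)%N -> (M `<=` V)%fset ->
    spans V L -> (size L < #|` V|)%N -> (2 * #|` M| - 2 < #|` V|)%N ->
  exists v, [/\ v \in V, v \notin M & (deg L v <= 2)%N].
Proof.
move=> M2 MV VL szL big; apply: contrapT => nov.
have V2 : (1 < #|` V|)%N := leq_trans M2 (fsubset_leq_card MV).
have deg3 v : v \in V -> (3 <= deg L v + 2 * (v \in M))%N.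
  move=> vV; have := deg_gt0 _ _ _ V2 VL vV.
  have [vM|vM] := boolP (v \in M); first by lia.
  move=> _; rewrite muln0 addn0; apply: contrapT => /negP.
  by rewrite -ltnNge => v2; apply: nov; exists v.
have : (\sum_(v <- V) 3 <= \sum_(v <- V) (deg L v + 2 * (v \in M)))%N.
  by rewrite !big_seq; apply: leq_sum.
have : (\sum_(v <- V) (v \in M) <= #|` M|)%N.
  rewrite -big_mkcond sum1_count -size_filter.
  apply: uniq_leq_size; first exact: filter_uniq.
  by move=> v; rewrite mem_filter => /andP[].
have := sum_deg V L.
rewrite big_split -big_distrr big_const_seq count_predT iter_addn_0 /=.
move: szL big M2; move: (\sum_(v <- V) deg L v)%N (\sum_(v <- V) (v \in M))%N.
by move: #|` V| #|` M| (size L) => v m l s t; lia.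
Qed.

(** Each end that moves from [v] to [u] lengthens its edge by at most [mdist u v]. The edge [e]
    instead becomes a loop, which is [2 * mdist u v] below this bound, so nothing grows when the
    degree is at most 2. *)
Lemma len_merge u v L e : e \in L -> (e == (u, v)) || (e == (v, u)) -> u != v ->
  len (map (map_edge (merge_pt u v)) L) + 2 * mdist u v <=
  len L + mdist u v * (deg L v)%:R.
Proof.
move=> eL euv uv.
have step (e' : X * X) : mdist (merge_pt u v e'.1) (merge_pt u v e'.2) <=
    mdist e'.1 e'.2 + mdist u v * ((e'.1 == v) + (e'.2 == v))%:R.
  case: e' => x y; rewrite /merge_pt /=.
  have := mdist_ge0 u v.
  case: (eqVneq x v) => [->|_]; case: (eqVneq y v) => [->|_] /=.
  - by rewrite !mdistxx => ?; lra.
  - have := metric_triangle u v y; lra.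
  - have := metric_triangle x v u; rewrite (metric_sym v u); lra.
  - lra.
rewrite /len /deg big_map natr_sum mulr_sumr -big_split /=.
rewrite (big_rem e) //= [leRHS](big_rem e) //=.
have : \sum_(y <- rem e L) mdist (merge_pt u v y.1) (merge_pt u v y.2) <=
    \sum_(y <- rem e L) (mdist y.1 y.2 + mdist u v * ((y.1 == v) + (y.2 == v))%:R).
  by apply: ler_sum => y _; exact: step.
suff : mdist (merge_pt u v e.1) (merge_pt u v e.2) + 2 * mdist u v =
    mdist e.1 e.2 + mdist u v * ((e.1 == v) + (e.2 == v))%:R by lra.
case/orP: euv => /eqP -> /=; rewrite -merge_pt_eq mdistxx eqxx (negbTE uv).
  by rewrite /=; lra.
by rewrite (metric_sym v u) /=; lra.
Qed.

(** Induction on the number of vertices. The contracted vertex lies outside [M], so [M] stays in the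
    vertex set. A fresh tree is extracted in every round because contraction leaves a loop
    behind. *)
Lemma few_vertices M V L : (1 < #|` M|)%N -> (M `<=` V)%fset ->
    edges_in V L -> spans V L ->
  exists V' L', [/\ (M `<=` V')%fset, (#|` V'| <= 2 * #|` M| - 2)%N,
    edges_in V' L', spans V' L' & len L' <= len L].
Proof.
move=> M2; have [n sz] := ubnP #|` V|.
elim: n V L sz => // n IH V L sz MV inL VL.
have [small|big] := leqP #|` V| (2 * #|` M| - 2); first by exists V, L; split.
have V2 : (1 < #|` V|)%N := leq_trans M2 (fsubset_leq_card MV).
have V0 : V != fset0 by rewrite -cardfs_gt0 (ltn_trans _ V2).
have [L1 [sL VL1 szL]] := spanning_tree _ _ V0 inL VL.
have len1 : len L1 <= len L.
  have /subseqP[m _ ->] := sL.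
  rewrite /len; elim: (L) (m) => [|e s IHs] [|[] m'] //=.
  - by rewrite big_nil len_ge0.
  - by rewrite !big_cons lerD2l.
  - by rewrite big_cons (le_trans (IHs _)) // lerDr mdist_ge0.
have inL1 : edges_in V L1 by move=> e /(mem_subseq sL); exact: inL.
have [v [vV vM dv]] := low_degree _ _ _ M2 MV VL1 szL big.
have [u [e [eL1 euv uV uv]]] : exists u e, [/\ e \in L1,
    (e == (u, v)) || (e == (v, u)), u \in V & v != u].
  have [[x y] eL /=] := incident_edge _ _ _ V2 VL1 vV.
  have /andP[/= xV yV] := inL1 _ eL.
  case: (eqVneq x v) => [xv|xv]; case: (eqVneq y v) => [yv|yv] // _.
    by exists y, (x, y); rewrite eL xv eqxx orbT (eq_sym v) yv yV.
  by exists x, (x, y); rewrite eL yv eqxx (eq_sym v) xv xV.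
pose phi := merge_pt u v.
have phiV : (phi @` V)%fset = (V `\ v)%fset by exact: merge_pt_fset.
have [|||| V' [L' [MV' small inL' VL' len']]] :=
    IH (phi @` V)%fset (map (map_edge phi) L1).
- by rewrite phiV; move: sz; rewrite (cardfsD1 v V) vV.
- by rewrite phiV fsubsetD1 MV.
- by move=> _ /mapP[e' /inL1 /andP[e1 e2] ->] /=; rewrite !in_imfset.
- exact: spans_map.
exists V', L'; split => //; apply: le_trans len' (le_trans _ len1).
have := len_merge _ _ _ _ eL1 euv; rewrite eq_sym => /(_ uv).
have : mdist u v * (deg L1 v)%:R <= mdist u v * 2.
  by rewrite ler_wpM2l ?mdist_ge0 // ler_nat.
rewrite -/phi; lra.
Qed.

End weighted_edge_lists.

(** * Metric spaces built from a distance function *)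

Section distance_type.
Context {R : realType} {T : choiceType}.

(** The axioms are arguments of this copy of [T], so that each distance function gets a metric
    structure of its own. *)
Definition dist_type (d : T -> T -> R)
  (_ : forall x, d x x = 0) (_ : forall x y, d x y = 0 -> x = y)
  (_ : forall x y, d x y = d y x)
  (_ : forall y x z, d x z <= d x y + d y z) : Type := T.

Variables (d : T -> T -> R) (dxx : forall x, d x x = 0)
  (d_eq0 : forall x y, d x y = 0 -> x = y) (dC : forall x y, d x y = d y x)
  (d_triangle : forall y x z, d x z <= d x y + d y z).

HB.instance Definition _ := Choice.on (dist_type d dxx d_eq0 dC d_triangle).
HB.instance Definition _ :=
  isMetric.Build R (dist_type d dxx d_eq0 dC d_triangle) dxx d_eq0 dC d_triangle.

End distance_type.

(** * Gromov--Hausdorff distance to a simplex *)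

Section gromov_hausdorff_simplex.
Context {R : realType} {X : metricType R}.
Implicit Types (V : {fset X}) (lambda : {posnum R}).

Definition dGH_bounds (Y Z : metricType R) (A : set Y) (B : set Z) : set R :=
  [set r : R | exists (W : metricType R) (A' B' : set W),
    [/\ isometric A A', isometric B B' & (hausdorff_dist A' B' <= r%:E)%E]].

(** The slack between [r] and [s] replaces infima that need not be attained by actual points. *)
Lemma hausdorff_dist_near (Z : metricType R) (A B : set Z) (r s : R) :
  (hausdorff_dist A B <= r%:E)%E -> r < s ->
  (forall a, A a -> exists2 b, B b & mdist a b < s) /\
  (forall b, B b -> exists2 a, A a & mdist a b < s).
Proof.
rewrite /hausdorff_dist ge_max => /andP[rA rB] rs.
have near (C D : set Z) c : (ereal_sup (dist_to_set D @` C) <= r%:E)%E ->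
    C c -> exists2 d, D d & mdist c d < s.
  move=> rC Cc.
  have : (dist_to_set D c < s%:E)%E.
    apply: (@le_lt_trans _ _ r%:E); last by rewrite lte_fin.
    by apply: le_trans rC; apply: ereal_sup_ubound; exists c.
  by move=> /ereal_inf_lt[_ [d Dd <-]]; rewrite lte_fin; exists d.
split=> [a Aa|b Bb]; first exact: near Aa.
by have [a Aa] := near B A b rB Bb; rewrite metric_sym; exists a.
Qed.

Lemma dGH_bounds_ge0 (Y Z : metricType R) (A : set Y) (B : set Z) :
  A !=set0 -> lbound (dGH_bounds Y Z A B) 0.
Proof.
move=> [a Aa] r [W [A' [B' [[f _ fA] _ Hr]]]].
apply/ler_addgt0Pr => s s0.
have rs : r < r + s by rewrite ltrDl.
have [+ _] := hausdorff_dist_near _ _ _ _ _ Hr rs.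
move=> /(_ (f a))[|b _ /ltW]; first by rewrite -fA; exists a.
by apply: le_trans; exact: mdist_ge0.
Qed.

Section glued_metric.
Variables (V : {fset X}) (lambda : {posnum R}) (m : nat).
Variables (f : X -> 'I_m) (D delta : R).
(** Conditions for a metric on the disjoint union: [delta_lt] keeps points away from vertices, [VD]
    and [deltaD] give the triangle inequality from point to point through a vertex, and [gap] the
    one from a point to a vertex through another point. *)
Hypothesis VD : {in V &, forall x y, mdist x y <= D}.
Hypothesis delta0 : 0 <= delta.
Hypothesis delta_lt : delta < lambda%:num.
Hypothesis deltaD : D + delta <= lambda%:num.
Hypothesis gap : {in V &, forall x y, f x != f y -> delta <= mdist x y}.

Let T : choiceType := (V + 'I_m)%type.

(* A point of [V] and a vertex of the simplex are at distance half the
   distortion of the correspondence [{(x, f x)}] if they correspond to each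
   other, and [delta] further away if not. *)
Let mixed (x : V) (i : 'I_m) : R :=
  if f (val x) == i then (lambda%:num - delta) / 2
  else (lambda%:num + delta) / 2.

Let glued (p q : T) : R :=
  match p, q with
  | inl x, inl y => mdist (val x) (val y)
  | inl x, inr j => mixed x j
  | inr i, inl y => mixed y i
  | inr i, inr j => simplex_dist (i : simplex lambda m) j
  end.

Let mixed_bounds x i : (lambda%:num - delta) / 2 <= mixed x i /\
  mixed x i <= (lambda%:num + delta) / 2.
Proof. by move: delta0; rewrite /mixed; case: ifP => _ d0; split; lra. Qed.

Let gluedxx p : glued p p = 0.
Proof. by case: p => [x|i] /=; [exact: mdistxx|rewrite /simplex_dist eqxx]. Qed.

Let gluedC p q : glued p q = glued q p.
Proof.
case: p q => [x|i] [y|j] //=; first exact: metric_sym.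
by rewrite /simplex_dist eq_sym.
Qed.

Let glued_eq0 p q : glued p q = 0 -> p = q.
Proof.
move: delta0 delta_lt => d0 d_lt; case: p q => [x|i] [y|j] /=.
- by move=> /mdist_positivity /val_inj ->.
- by have [] := mixed_bounds x j => *; exfalso; lra.
- by have [] := mixed_bounds y i => *; exfalso; lra.
- by rewrite /simplex_dist; case: eqP => [->//|_ /eqP]; rewrite gt_eqF.
Qed.

Let glued_triangle q p r : glued p r <= glued p q + glued q r.
Proof.
have lam0 : 0 < lambda%:num by [].
move: delta0 delta_lt deltaD => d0 d_lt Dd.
case: p q r => [x|i] [y|j] [z|k] /=.
- exact: metric_triangle.
- have := mdist_ge0 (val x) (val y); rewrite /mixed.
  case: (eqVneq (f (val y)) k) => [<-|_]; last by case: ifP => _ ?; lra.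
  case: eqVneq => [_ ?|xy ?]; first lra.
  by have := gap _ _ (valP x) (valP y) xy; lra.
- have := VD _ _ (valP x) (valP z).
  by have [] := mixed_bounds x j; have [] := mixed_bounds z j; lra.
- have [? ?] := mixed_bounds x j; have [? ?] := mixed_bounds x k.
  by rewrite /simplex_dist; case: (eqVneq j k) => [->|_]; lra.
- have := mdist_ge0 (val y) (val z); rewrite /mixed.
  case: (eqVneq (f (val y)) i) => [<-|_]; last by case: ifP => _ ?; lra.
  case: eqVneq => [_ ?|xy ?]; first lra.
  by have := gap _ _ (valP z) (valP y) xy; rewrite metric_sym; lra.
- rewrite /simplex_dist /mixed; case: (eqVneq i k) => [->|ik].
    by have := mixed_bounds y k; rewrite /mixed; case: ifP => _; lra.
  case: (eqVneq (f (val y)) i) => [->|_]; last by case: ifP => _; lra.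
  by rewrite (negbTE ik); lra.
- have [? ?] := mixed_bounds z i; have [? ?] := mixed_bounds z j.
  by rewrite /simplex_dist; case: (eqVneq i j) => [->|_]; lra.
- rewrite /simplex_dist.
  case: (eqVneq i j) => [<-|_]; first by rewrite add0r.
  by case: (i == k); case: (j == k); lra.
Qed.

Let Z : metricType R := dist_type glued gluedxx glued_eq0 gluedC glued_triangle.

(** Each point is within this bound of its own vertex. A vertex in turn needs a point over it,
    unless [delta = 0], when all mixed distances are half of [lambda]. *)
Lemma glued_dGH_bounds : V != fset0 ->
  delta = 0 \/ (forall i, exists2 x, x \in V & f x = i) ->
  dGH_bounds X (simplex lambda m) [set` V] [set: simplex lambda m]
    ((lambda%:num - delta) / 2).
Proof.
move=> /fset0Pn[x0 x0V] onto.
(* Points outside [V] are sent to [x0], which makes [phi] total. *)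
pose phi (x : X) : Z := inl (insubd [` x0V]%fset x).
pose psi (i : simplex lambda m) : Z := inr i.
have mixed_le (x : V) (i : 'I_m) : f (val x) = i \/ delta = 0 ->
    mixed x i <= (lambda%:num - delta) / 2.
  by rewrite /mixed => -[->|->]; [rewrite eqxx|case: ifP => _; lra].
have dist_le (A : set Z) (z w : Z) : A w -> glued z w <= (lambda%:num - delta) / 2 ->
    (dist_to_set A z <= ((lambda%:num - delta) / 2)%:E)%E.
  move=> Aw zw; apply: (@le_trans _ _ (mdist z w)%:E); last by rewrite lee_fin.
  by apply: ereal_inf_lbound; exists w.
exists Z, (phi @` [set` V]), (psi @` setT); split.
- exists phi => // x y xV yV; rewrite /phi.
  have -> : mdist (inl (insubd [` x0V]%fset x) : Z) (inl (insubd [` x0V]%fset y)) =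
    mdist (val (insubd [` x0V]%fset x)) (val (insubd [` x0V]%fset y)) by [].
  by rewrite !val_insubd; move: xV yV => /= -> ->.
- by exists psi.
rewrite /hausdorff_dist ge_max; apply/andP; split.
  apply: ge_ereal_sup => _ [_ [x xV <-] <-].
  apply: (dist_le _ _ (psi (f x))); first by exists (f x).
  by apply: mixed_le; left; rewrite val_insubd; move: xV => /= ->.
apply: ge_ereal_sup => _ [_ [i _ <-] <-].
case: onto => [d0|/(_ i)[x xV fx]].
  apply: (dist_le _ _ (phi x0)); first by exists x0.
  by apply: mixed_le; right.
apply: (dist_le _ _ (phi x)); first by exists x.
by apply: mixed_le; left; rewrite val_insubd xV.
Qed.

Lemma dGH_simplex_le : V != fset0 ->
  delta = 0 \/ (forall i, exists2 x, x \in V & f x = i) ->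
  2 * dGH [set` V] [set: simplex lambda m] <= lambda%:num - delta.
Proof.
move=> V0 onto; have /fset0Pn[x0 x0V] := V0.
suff : dGH [set` V] [set: simplex lambda m] <= (lambda%:num - delta) / 2 by lra.
apply: ge_inf; last exact: glued_dGH_bounds.
by exists 0; apply: dGH_bounds_ge0; exists x0.
Qed.

End glued_metric.

(* A metric realising a smaller distance assigns to each point of [V] the only
   vertex of the simplex near it, and this is a surjection [f] for which all
   points in distinct fibres are at distance greater than [e]. *)
Lemma dGH_simplex_ge V lambda k D e : V != fset0 ->
    {in V &, forall x y, mdist x y <= D} -> D <= lambda%:num -> 0 <= e ->
    (forall f : X -> 'I_k.+1, (forall i, exists2 x, x \in V & f x = i) ->
      exists x y, [/\ x \in V, y \in V, f x != f y & mdist x y <= e]) ->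
  lambda%:num - e <= 2 * dGH [set` V] [set: simplex lambda k.+1].
Proof.
move=> V0 VD Dl e0 close.
suff : (lambda%:num - e) / 2 <= dGH [set` V] [set: simplex lambda k.+1] by lra.
apply: lb_le_inf.
  (* The infimum needs some bound to exist; the constant map with gap 0 supplies half of
     [lambda]. *)
  exists ((lambda%:num - 0) / 2).
  apply: (@glued_dGH_bounds _ _ _ (fun=> ord0) D); rewrite ?addr0 //.
  by left.
move=> r [Z [A' [B' [[phi phiE phiV] [psi psiE psiT] Hr]]]].
rewrite leNgt; apply/negP => rlt.
(* The midpoint of [r] and the claimed bound leaves room on both sides: [r < s] and
   [2 * s < lambda - e]. *)
pose s := (r + (lambda%:num - e) / 2) / 2.
have [near1 near2] := hausdorff_dist_near _ _ _ _ s Hr ltac:(rewrite /s; lra).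
have s_small : 2 * s < lambda%:num - e by rewrite /s; lra.
have far (i j : simplex lambda k.+1) : i != j -> mdist (psi i) (psi j) = lambda%:num.
  move=> ij; rewrite psiE //; have -> : mdist i j = simplex_dist i j by [].
  by rewrite /simplex_dist (negbTE ij).
pose f x : 'I_k.+1 := xget ord0 [set i | mdist (phi x) (psi i) < s].
have fP x : x \in V -> mdist (phi x) (psi (f x)) < s.
  move=> xV; have [|b Bb xb] := near1 (phi x); first by rewrite -phiV; exists x.
  move: Bb xb; rewrite -psiT => -[i _ <-] xi.
  exact: (@xgetPex _ ord0 [set i | mdist (phi x) (psi i) < s]) (ex_intro _ i xi).
have [i|x [y [xV yV fxy xy]]] := close f.
  have [|a Aa ai] := near2 (psi i); first by rewrite -psiT; exists i.
  move: Aa ai; rewrite -phiV => -[x xV <-] xi; exists x => //.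
  apply/eqP; apply: contrapT => /negP fxi.
  have := far _ _ fxi; have := metric_triangle (psi (f x)) (phi x) (psi i).
  by have := fP x xV; rewrite (metric_sym (psi (f x)) (phi x)); lra.
have := far _ _ fxy; have := fP x xV; have := fP y yV.
have := metric_triangle (psi (f x)) (phi x) (psi (f y)).
have := metric_triangle (phi x) (phi y) (psi (f y)).
by rewrite (metric_sym (psi (f x)) (phi x)) (phiE x y xV yV); lra.
Qed.

End gromov_hausdorff_simplex.

(** * Terms of the series as gaps of partitions *)

Section simplex_terms.
Context {R : realType} {X : metricType R}.
Implicit Types (V : {fset X}) (lambda : {posnum R}).

Definition simplex_term lambda V (k : nat) : R :=
  lambda%:num - 2 * dGH [set` V] [set: simplex lambda k.+1].

(** The fibres of [f] are the classes of a partition, and numbering them gives the map to the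
    simplex. As [delta <= D], the bound on [2 * D] yields [D + delta <= lambda]. *)
Lemma gap_le_simplex_term V lambda D (f : X -> X) k delta :
    {in V &, forall x y, mdist x y <= D} -> 2 * D <= lambda%:num ->
    #|` (f @` V)%fset| = k.+1 -> 0 <= delta <= D ->
    {in V &, forall x y, f x != f y -> delta <= mdist x y} ->
  delta <= simplex_term lambda V k.
Proof.
move=> VD Dl fV /andP[delta0 deltaD] gap.
have lam0 : 0 < lambda%:num by [].
set W := (f @` V)%fset in fV.
have [V0|[x0 x0V]] := fset_0Vmem V.
  by move: fV; rewrite /W V0 imfset0 cardfs0.
have idx x : x \in V -> (index (f x) (enum_fset W) < k.+1)%N.
  by move=> xV; rewrite -fV index_mem in_imfset.
pose g x : 'I_k.+1 := inord (index (f x) (enum_fset W)).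
suff : 2 * dGH [set` V] [set: simplex lambda k.+1] <= lambda%:num - delta.
  by rewrite /simplex_term; lra.
apply: (@dGH_simplex_le _ _ V lambda k.+1 g D) => //; try lra.
- move=> x y xV yV gxy; apply: gap => //; apply: contra_neq gxy => fxy.
  by rewrite /g fxy.
- by apply/fset0Pn; exists x0.
right=> i; have iW : (i < size (enum_fset W))%N by rewrite fV.
have /imfsetP[/= x xV xi] : nth (f x0) (enum_fset W) i \in W by exact: mem_nth.
by exists x => //; rewrite /g -xi index_uniq ?fset_uniq // inord_val.
Qed.

(** At most [k] points cannot be mapped onto [k + 1] vertices, so the condition of the lower bound
    holds vacuously with [e = 0]. A constant map with gap 0 gives the other inequality. *)
Lemma simplex_term_big V lambda D k : V != fset0 ->
    {in V &, forall x y, mdist x y <= D} -> 2 * D <= lambda%:num ->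
  (#|` V| <= k)%N -> simplex_term lambda V k = 0.
Proof.
move=> V0 VD Dl Vk; have lam0 : 0 < lambda%:num by [].
have D0 : 0 <= D.
  by have /fset0Pn[x xV] := V0; rewrite (le_trans _ (VD x x xV xV)) ?mdistxx.
have Dlam : D <= lambda%:num by lra.
apply/eqP; rewrite eq_le /simplex_term; apply/andP; split.
  suff : lambda%:num - 0 <= 2 * dGH [set` V] [set: simplex lambda k.+1] by lra.
  apply: (@dGH_simplex_ge _ _ _ _ _ D) => // f onto; exfalso.
  have : ([fset i | i : 'I_k.+1] `<=` f @` V)%fset.
    apply/fsubsetP => i _; have [x xV <-] := onto i; exact: in_imfset.
  move=> /fsubset_leq_card; rewrite card_imfset //= -cardE card_ord.
  by move=> /leq_trans /(_ (leq_imfset_card _ _ _)) /leq_trans /(_ Vk); rewrite ltnn.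
suff : 2 * dGH [set` V] [set: simplex lambda k.+1] <= lambda%:num - 0 by lra.
apply: (@dGH_simplex_le _ _ V lambda k.+1 (fun=> ord0) D); rewrite ?addr0 //.
by left.
Qed.

(* Kruskal's algorithm: repeatedly merge two closest classes of the partition
   of [V] into fibres of [f]. *)
Lemma greedy_tree V lambda D k (f : X -> X) :
    {in V &, forall x y, mdist x y <= D} -> 2 * D <= lambda%:num ->
    #|` (f @` V)%fset| = k.+1 ->
  exists L, [/\ edges_in V L, spans (f @` V)%fset (map (map_edge f) L) &
    len L <= \sum_(1 <= j < k.+1) simplex_term lambda V j].
Proof.
move=> VD Dl; elim: k f => [|k IH] f fV.
  exists [::]; split=> //; last by rewrite /len big_nil big_geq.
  have /cardfs1P[c ->] : #|` (f @` V)%fset| == 1%N by rewrite fV.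
  by move=> g _ x y; rewrite !inE => /eqP -> /eqP ->.
have [a [b [aV bV ab]]] : exists a b, [/\ a \in V, b \in V & f a != f b].
  apply: contrapT => nab; have [V0|[x xV]] := fset_0Vmem V.
    by move: fV; rewrite V0 imfset0 cardfs0.
  have : (f @` V `<=` [fset f x])%fset.
    apply/fsubsetP => _ /imfsetP[/= y yV ->]; rewrite inE.
    by apply: contrapT => /negP fxy; apply: nab; exists y, x.
  by move=> /fsubset_leq_card; rewrite fV cardfs1.
pose P (p : V * V) := f (val p.1) != f (val p.2).
have P0 : P ([` aV]%fset, [` bV]%fset) by [].
case: (arg_minP (fun p : V * V => mdist (val p.1) (val p.2)) P0).
move=> [[x xV] [y yV]]; rewrite /P /= => fxy xymin.
have {P P0 xymin}gap : {in V &, forall x' y', f x' != f y' -> mdist x y <= mdist x' y'}.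
  by move=> x' y' x'V y'V; exact: (xymin ([` x'V]%fset, [` y'V]%fset)).
(* The current partition has [k + 2] classes, so its gap is bounded by term [k + 1]; the induction
   hypothesis accounts for terms 1 to [k]. *)
have xyt : mdist x y <= simplex_term lambda V k.+1.
  by apply: (gap_le_simplex_term _ _ D f) => //; rewrite mdist_ge0 VD.
pose g := merge_pt (f x) (f y) \o f.
have gV : (g @` V = (f @` V) `\ f y)%fset.
  by rewrite imfset_comp merge_pt_fset ?in_imfset // eq_sym.
have [|L [inL VL lenL]] := IH g.
  apply/eqP; rewrite -eqSS -fV gV (cardfsD1 (f y) (f @` V)%fset).
  by rewrite in_imfset.
exists ((x, y) :: L); split.
- by move=> e; rewrite inE => /predU1P[->|/inL//]; rewrite xV yV.
- move=> h hL u v uV vV.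
  have hxy : h (f x) = h (f y) by exact: (hL _ (mem_head _ _)).
  have hm z : h (merge_pt (f x) (f y) z) = h z.
    by rewrite /merge_pt; case: eqVneq => // ->.
  rewrite -hm -[RHS]hm; apply: VL; last 2 first.
  + by rewrite /g imfset_comp in_imfset.
  + by rewrite /g imfset_comp in_imfset.
  move=> _ /mapP[e eL ->] /=; rewrite !hm.
  by apply: (hL (map_edge f e)); rewrite inE map_f ?orbT.
- by rewrite /len big_cons /= big_nat_recr //= addrC lerD.
Qed.

(** The greedy procedure starts from the partition into singletons. *)
Lemma simplex_sum_ge_len V lambda D : V != fset0 ->
    {in V &, forall x y, mdist x y <= D} -> 2 * D <= lambda%:num ->
  exists L, [/\ edges_in V L, spans V L &
    len L <= \sum_(1 <= j < #|` V|) simplex_term lambda V j].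
Proof.
rewrite -cardfs_gt0 => V0 VD Dl.
have := @greedy_tree V lambda D #|` V|.-1 id VD Dl.
rewrite imfset_id prednK // => /(_ erefl)[L [inL VL lenL]].
exists L; split => //; move: VL; congr spans.
by rewrite -[RHS]map_id; apply: eq_map => -[].
Qed.

(** If all edges of [L2] lay inside the classes of a partition, they would collapse to loops. The
    edges of [L1] alone would then connect all [size L1 + 2] classes, which is one class too
    many. *)
Lemma simplex_term_le_edge V lambda D L1 e L2 : V != fset0 ->
    {in V &, forall x y, mdist x y <= D} -> D <= lambda%:num ->
    edges_in V L2 -> spans V (L1 ++ L2) ->
    {in L2, forall e', mdist e'.1 e'.2 <= e} -> 0 <= e ->
  simplex_term lambda V (size L1).+1 <= e.
Proof.
move=> V0 VD Dl inL2 VL L2e e0.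
suff : lambda%:num - e <=
    2 * dGH [set` V] [set: simplex lambda (size L1).+2].
  by rewrite /simplex_term; lra.
apply: (@dGH_simplex_ge _ _ _ _ _ D) => // f onto.
apply: contrapT => far.
have := spans_map _ _ f _ _ VL; rewrite map_cat => /spans_cat_loops fVL.
have /spans_size : spans (f @` V)%fset (map (map_edge f) L1).
  apply: fVL => _ /mapP[e' e'L2 ->] /=.
  have /andP[e1 e2] := inL2 _ e'L2.
  apply/eqP; apply: contrapT => /negP fe; apply: far.
  by exists e'.1, e'.2; split => //; exact: L2e.
have : ([fset i | i : 'I_(size L1).+2] `<=` f @` V)%fset.
  apply/fsubsetP => i _; have [x xV <-] := onto i; exact: in_imfset.
move=> /fsubset_leq_card; rewrite card_imfset //= -cardE card_ord size_map.
by move=> /leq_trans h /h; rewrite ltnn.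
Qed.

Lemma simplex_sum_le_len V lambda D L : V != fset0 ->
    {in V &, forall x y, mdist x y <= D} -> D <= lambda%:num ->
    edges_in V L -> spans V L ->
  \sum_(1 <= j < #|` V|) simplex_term lambda V j <= len L.
Proof.
move=> V0 VD Dl inL VL.
have szL := spans_size _ _ VL.
have /fset0Pn[x0 _] := V0.
(* Longest edges come first: the edge at position [i], counted from 0, then bounds term [i + 1],
   with the [i] edges before it in the role of [L1]. *)
pose ge_edge (e e' : X * X) := mdist e'.1 e'.2 <= mdist e.1 e.2.
have ge_refl : reflexive ge_edge by move=> e; exact: lexx.
have ge_trans : transitive ge_edge by move=> e1 e2 e3 /[swap]; exact: le_trans.
have ge_total : total ge_edge by move=> e e'; exact: le_total.
have memS := mem_sort ge_edge L.
have sizeS := size_sort ge_edge L.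
have sortedS := sort_sorted ge_total L.
have lenS : len L = len (sort ge_edge L).
  by rewrite /len (perm_big _ (permEl (perm_sort ge_edge L))).
rewrite {}lenS; move: (sort ge_edge L) memS sizeS sortedS => S memS sizeS sortedS.
pose w i := mdist (nth (x0, x0) S i).1 (nth (x0, x0) S i).2.
have -> : len S = \sum_(0 <= i < size S) w i.
  by rewrite /len (big_nth (x0, x0)).
have cardV : (#|` V|.-1 <= size S)%N by rewrite sizeS; case: #|` V| szL.
apply: (@le_trans _ _ (\sum_(0 <= i < #|` V|.-1) w i)); last first.
  rewrite [leRHS](big_cat_nat _ cardV) //= lerDl.
  by apply: sumr_ge0 => i _; exact: mdist_ge0.
rewrite big_add1 big_nat [leRHS]big_nat; apply: ler_sum => i /andP[_ iV].
have iS : (i < size S)%N := leq_trans iV cardV.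
have {1}-> : i = size (take i S) by rewrite size_takel // ltnW.
apply: (@simplex_term_le_edge _ _ D _ _ (drop i S)) => //.
- by move=> e /mem_drop; rewrite memS; exact: inL.
- by rewrite cat_take_drop => g gS; apply: VL => e; rewrite -memS; exact: gS.
- move=> e /(nthP (x0, x0))[j]; rewrite size_drop nth_drop => jS <-.
  apply: (sorted_leq_nth ge_trans ge_refl (x0, x0) sortedS); rewrite ?inE ?leq_addr //.
  by rewrite -ltn_subRL.
- exact: mdist_ge0.
Qed.

End simplex_terms.

(** * Translation between graphs and edge lists *)

Section graphs.
Context {R : realType} {X : metricType R}.
Implicit Types (V M : {fset X}) (L : seq (X * X)) (G : @graph R X).

Lemma ler_sum_undup (T : eqType) (F : T -> R) (s : seq T) :
  (forall x, 0 <= F x) -> \sum_(x <- undup s) F x <= \sum_(x <- s) F x.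
Proof.
move=> F0; elim: s => [|x s IH] /=; first by rewrite !big_nil.
by case: ifP => _; rewrite !big_cons ?lerD2l // (le_trans IH) // lerDr.
Qed.

(** Loops are dropped and parallel edges become a single two-point set, so the length may
    decrease. *)
Lemma graph_of_edges V L : edges_in V L -> spans V L ->
  exists G, [/\ vertices G = V, connected_graph G & graph_length G <= len L].
Proof.
move=> inL VL.
pose pairs := [seq [fset e.1; e.2]%fset | e <- L & e.1 != e.2].
have := seq_fset_perm tt pairs; have := seq_fsetE tt pairs.
move: (seq_fset tt pairs) => E memE permE.
have pairsP (e : {fset X}) : e \in E -> (e `<=` V)%fset /\ #|` e| = 2.
  rewrite memE => /mapP[[a b]]; rewrite mem_filter => /andP[/= ab abL] ->.
  have /andP[/= aV bV] := inL _ abL.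
  split; last by rewrite cardfs2 ab.
  by apply/fsubsetP => z; rewrite !inE => /orP[] /eqP ->.
exists (Graph pairsP); split => //.
- move=> v w.
  (* The cut is the component of [v], extended by [false] outside the vertex set. *)
  pose g z := if insub z is Some z' then connect (@Defs.adjacent R X (Graph pairsP)) v z'
              else false.
  have gval (z : vertices (Graph pairsP)) :
      g (val z) = connect (@Defs.adjacent R X (Graph pairsP)) v z.
    by rewrite /g valK.
  rewrite -gval (VL g _ (val w) (val v)) ?gval ?connect0 //; try exact: fsvalP.
  move=> [a b] abL /=; have [->//|ab] := eqVneq a b.
  have /andP[/= aV bV] := inL _ abL.
  have := gval [` aV]%fset; have := gval [` bV]%fset => /= -> ->.
  have adj : Defs.adjacent (G := Graph pairsP) [` aV]%fset [` bV]%fset.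
    rewrite /Defs.adjacent /= memE; apply/mapP; exists (a, b) => //.
    by rewrite mem_filter /= ab.
  apply/idP/idP => /connect_trans; apply; apply: connect1 => //.
  by rewrite /Defs.adjacent fsetUC.
- rewrite /graph_length /= (perm_big _ permE) /=.
  (* This covers every finite set, including the empty one; where no supremum exists, [sup] is 0. *)
  have len_ge0 (e : {fset X}) : 0 <= edge_length e.
    rewrite /edge_length /diam; set S := (X in sup X).
    have [Ssup|/sup_out ->//] := pselect (has_sup S).
    have [[r Sr] [M SM]] := Ssup; apply: (@le_trans _ _ r).
      by case: Sr => p _ <-; exact: mdist_ge0.
    by apply: ub_le_sup => //; exists M.
  apply: (le_trans (ler_sum_undup _ _ _ len_ge0)).
  rewrite big_map big_filter big_mkcond; apply: ler_sum => e _.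
  by rewrite diam_pair; case: ifP => // _; exact: mdist_ge0.
Qed.

(** The ends of each two-point edge are ordered by choice. A cut that no edge crosses is then
    constant along every path. *)
Lemma edges_of_graph G : vertices G != fset0 -> connected_graph G ->
  exists L, [/\ edges_in (vertices G) L, spans (vertices G) L &
    len L = graph_length G].
Proof.
move=> /fset0Pn[x0 _] connG.
have /choice[ends endsP] : forall e, exists p : X * X,
    e \in edges G -> e = [fset p.1; p.2]%fset.
  move=> e; have [eG|eG] := boolP (e \in edges G); last by exists (x0, x0).
  have [_ e2] := edgesP eG.
  have /fset0Pn[a ae] : e != fset0 by rewrite -cardfs_gt0 e2.
  have /cardfs1P[b eb] : #|` (e `\ a)%fset| == 1%N.
    by move: e2; rewrite (cardfsD1 a e) ae add1n => -[->].
  by exists (a, b) => _; rewrite /= -eb fsetD1K.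
exists [seq ends e | e <- edges G]; split.
- move=> _ /mapP[e eG ->]; have [/fsubsetP sub _] := edgesP eG.
  by rewrite !sub // {2}(endsP _ eG) !inE eqxx ?orbT.
- move=> g gL x y xG yG.
  have /connectP[p] := connG [` xG]%fset [` yG]%fset.
  rewrite -[x]/(val [` xG]%fset) -[y]/(val [` yG]%fset).
  move: [` xG]%fset [` yG]%fset => {x y xG yG} x y.
  elim: p x => [|z p IH] x /=; first by move=> _ ->.
  move=> /andP[xz zp] /(IH _ zp) <-.
  have ends_xz := endsP _ xz; have gE := gL _ (map_f ends xz).
  have g_end (u : X) : u \in [fset val x; val z]%fset ->
      g u = g (ends [fset val x; val z]%fset).1.
    by rewrite {1}ends_xz !inE => /orP[] /eqP -> //.
  by rewrite (g_end (val x)) ?(g_end (val z)) // !inE eqxx ?orbT.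
- by rewrite /len big_map /graph_length !big_seq; apply: eq_bigr => e eG;
    rewrite [in RHS](endsP _ eG) diam_pair.
Qed.

End graphs.

Lemma diam_ge (R : realType) (X : metricType R) (V : {fset X}) :
  {in V &, forall x y, mdist x y <= diam [set` V]}.
Proof.
move=> x y xV yV; apply: ub_le_sup; last by exists (x, y).
(* The sum of all distances serves as the upper bound that [sup] requires. *)
exists (\sum_(a <- V) \sum_(b <- V) mdist a b) => _ [[a b] [/= aV bV] <-] /=.
rewrite (big_rem a) //= (big_rem b) //= -addrA lerDl addr_ge0 //.
  by apply: sumr_ge0 => ? _; exact: mdist_ge0.
by apply: sumr_ge0 => ? _; apply: sumr_ge0 => ? _; exact: mdist_ge0.
Qed.

Lemma diam_le (R : realType) (X : metricType R) (V : {fset X}) (d : R) :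
  V != fset0 -> {in V &, forall x y, mdist x y <= d} -> diam [set` V] <= d.
Proof.
move=> /fset0Pn[x xV] Vd; apply: ge_sup; first by exists (mdist x x), (x, x).
by move=> _ [[a b] [/= aV bV] <-]; exact: Vd.
Qed.

(** * Steiner minimal trees and the sum of the series *)

Section steiner_minimal_tree.
Context {R : realType} {X : metricType R}.
Implicit Types (V M : {fset X}) (L : seq (X * X)) (G : @graph R X).

Lemma graph_length_ge0 G : connected_graph G -> 0 <= graph_length G.
Proof.
move=> connG; have [V0|V0] := eqVneq (vertices G) fset0; last first.
  by have [L [_ _ <-]] := edges_of_graph _ V0 connG; exact: len_ge0.
rewrite /graph_length big_seq big1 // => e /edgesP[].
by rewrite V0 fsubset0 => /eqP ->; rewrite cardfs0.
Qed.

Lemma smt_has_lbound M :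
  has_lbound [set graph_length G | G in [set G | connected_graph G /\ joins G M]].
Proof. by exists 0 => _ [G [connG _] <-]; exact: graph_length_ge0. Qed.

Lemma smt_le_len M V L : (M `<=` V)%fset -> edges_in V L -> spans V L ->
  smt M <= len L.
Proof.
move=> MV inL VL; have [G [VG connG GL]] := graph_of_edges _ _ inL VL.
apply: le_trans GL; apply: ge_inf; first exact: smt_has_lbound.
by exists G => //; split => //; rewrite /joins VG.
Qed.

(** The star centred at a point of [M]. It shows that some connected graph joins [M], and it gives
    the sample bound on [d]. *)
Lemma star_spans M : M != fset0 -> exists L, [/\ edges_in M L, spans M L &
  len L <= (#|` M|%:R - 1) * diam [set` M]].
Proof.
move=> /fset0Pn[x xM]; exists [seq (x, y) | y <- (M `\ x)%fset]; split.
- by move=> _ /mapP[y yM ->] /=; move: yM; rewrite xM !inE => /andP[].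
- move=> g gL; have gx y : y \in M -> g y = g x.
    move=> yM; have [->//|yx] := eqVneq y x.
    by rewrite (gL (x, y)) //; apply/mapP; exists y; rewrite // !inE yx.
  by move=> y z yM zM; rewrite !gx.
rewrite (cardfsD1 x M) xM natrD addrAC subrr add0r /len big_map big_seq.
apply: (@le_trans _ _ (\sum_(y <- (M `\ x)%fset | y \in (M `\ x)%fset) diam [set` M])).
  by apply: ler_sum => y /=; rewrite !inE => /andP[_ yM]; exact: diam_ge.
by rewrite -big_seq big_const_seq count_predT iter_addr_0 mulr_natl.
Qed.

Lemma smt_nonempty M : M != fset0 ->
  [set graph_length G | G in [set G | connected_graph G /\ joins G M]] !=set0.
Proof.
move=> /star_spans[L [inL ML _]]; have [G [GM connG _]] := graph_of_edges _ _ inL ML.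
by exists (graph_length G), G => //; split => //; rewrite /joins GM.
Qed.

Lemma smt_ge M (r : R) : M != fset0 ->
  (forall G, connected_graph G -> joins G M -> r <= graph_length G) -> r <= smt M.
Proof.
move=> M0 rG; apply: lb_le_inf; first exact: smt_nonempty.
by move=> _ [G [connG GM] <-]; exact: rG.
Qed.

(** The terms vanish from the cardinality of [V] on, so the partial sums are eventually constant and
    the infinite sum is a genuine limit. *)
Lemma simplex_series (lambda : {posnum R}) V (D : R) : V != fset0 ->
    {in V &, forall x y, mdist x y <= D} -> 2 * D <= lambda%:num ->
  \big[+%R/0]_(1 <= k <oo) simplex_term lambda V k =
  \sum_(1 <= k < #|` V|) simplex_term lambda V k.
Proof.
move=> V0 VD Dl; apply: lim_near_cst; first exact: Rhausdorff.
exists #|` V| => // n /= Vn.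
rewrite (big_cat_nat _ Vn) ?cardfs_gt0 //=.
rewrite [X in _ + X]big_nat [X in _ + X]big1 ?addr0 // => k /andP[Vk _].
exact: simplex_term_big VD Dl Vk.
Qed.

(** [V] is the vertex set after reduction. Its diameter is at most the length of the reduced edge
    list, hence at most that of [G], which is below [d]. *)
Lemma steiner_family_small_graph M G (d : R) (lambda : {posnum R}) :
    (1 < #|` M|)%N -> connected_graph G -> joins G M -> graph_length G < d ->
    2 * d <= lambda%:num ->
  exists2 V, steiner_family M d V &
    \big[+%R/0]_(1 <= k <oo) simplex_term lambda V k <= graph_length G.
Proof.
move=> M2 connG GM Gd dl.
have lam0 : 0 < lambda%:num by [].
have nonempty V : (M `<=` V)%fset -> V != fset0.
  by move=> /fsubset_leq_card MV; rewrite -cardfs_gt0 (leq_trans _ MV) // ltnW.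
have [L [inL VL lenL]] := edges_of_graph _ (nonempty _ GM) connG.
have [V' [L' [MV' V'small inL' VL' lenL']]] := few_vertices _ _ _ M2 GM inL VL.
have V'0 := nonempty _ MV'.
have V'd : {in V' &, forall x y, mdist x y <= d}.
  move=> x y xV yV; apply: le_trans (mdist_le_len _ _ VL' _ _ xV yV) _.
  by rewrite (le_trans lenL') // lenL ltW.
exists V'; first by split => //; exact: diam_le.
rewrite (simplex_series _ _ d) // -lenL (le_trans _ lenL') //.
by apply: (simplex_sum_le_len _ _ d) => //; lra.
Qed.

End steiner_minimal_tree.

Theorem corollary4p1 (R : realType) (X : metricType R) (M : {fset X})
    (M0 : M != fset0) :
  (forall d : R, (#|` M|%:R - 1) * diam [set` M] < d -> smt M < d) /\
  (forall (d : R) (lambda : {posnum R}), smt M < d -> 2 * d <= lambda%:num ->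
    smt M = inf [set \big[+%R/0]_(1 <= k <oo)
        (lambda%:num - 2 * dGH [set` V] [set: simplex lambda k.+1])
      | V in steiner_family M d]).
Proof.
have [L [inL ML lenL]] := star_spans _ M0.
have smt_star := le_trans (smt_le_len _ _ _ (fsubset_refl M) inL ML) lenL.
split=> [d|d lambda smtd dl]; first exact: le_lt_trans.
have [M1|M2] := leqP #|` M| 1.
  (* For one point [2n - 2 = 0], so no admissible [V] contains [M]. The infimum over the empty
     family is 0 by convention, and [smt M] is 0 as well. *)
  have cM : #|` M| = 1 by apply/eqP; rewrite eqn_leq M1 cardfs_gt0.
  have -> : steiner_family M d = set0.
    apply/seteqP; split => // V [MV]; rewrite cM muln1 subnn leqn0 cardfs_eq0 => /eqP V0.
    by move: MV; rewrite V0 fsubset0 (negbTE M0).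
  rewrite image_set0 inf0; apply/eqP; rewrite eq_le; apply/andP; split.
    by move: smt_star; rewrite cM subrr mul0r.
  by apply: smt_ge => // G connG _; exact: graph_length_ge0.
have term_lb V : steiner_family M d V ->
    smt M <= \big[+%R/0]_(1 <= k <oo) simplex_term lambda V k.
  move=> [MV _ diamV].
  have V0 : V != fset0.
    by rewrite -cardfs_gt0 (leq_trans _ (fsubset_leq_card MV)) // ltnW.
  have Vd : {in V &, forall x y, mdist x y <= d}.
    by move=> x y xV yV; apply: le_trans diamV; exact: diam_ge.
  rewrite (simplex_series _ _ d) //.
  have [L1 [inL1 VL1 /(le_trans _)]] := simplex_sum_ge_len _ lambda d V0 Vd dl.
  by apply; exact: smt_le_len MV inL1 VL1.
set S := [set _ | _ in _]; have S_lb : lbound S (smt M).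
  by move=> _ [V VM <-]; exact: term_lb.
have inf_le G : connected_graph G -> joins G M -> graph_length G < d ->
    inf S <= graph_length G.
  move=> connG GM Gd.
  have [V VM VG] := steiner_family_small_graph _ _ _ _ M2 connG GM Gd dl.
  by apply: le_trans VG; apply: ge_inf; [exists (smt M)|exists V].
(* Since [smt M < d], some joining graph [G0] is shorter than [d]; it makes the family nonempty. *)
have [_ [G0 [connG0 G0M] <-] G0d] := inf_lt (smt_nonempty _ M0) smtd.
have S0 : S !=set0.
  have [V VM _] := steiner_family_small_graph _ _ _ _ M2 connG0 G0M G0d dl.
  by exists (\big[+%R/0]_(1 <= k <oo) simplex_term lambda V k), V.
apply/eqP; rewrite eq_le; apply/andP; split; first exact: lb_le_inf.
(* A graph of length at least [d] is longer than [G0], so the bound for [G0] suffices. *)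
apply: smt_ge => // G connG GM; have [dG|] := leP d (graph_length G); last exact: inf_le.
by apply: le_trans dG; exact: le_trans (inf_le _ connG0 G0M G0d) (ltW G0d).
Qed.
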